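(* Let $(\Omega,\mathscr B)$ be a standard Borel space and $\mathscr C$ a concept class of Borel subsets of $\Omega$ (no further measurability assumption on the class). If $\mathscr C$ is PAC learnable under the family of all non-atomic Borel probability measures on $\Omega$, then $\mathrm{VC}(\mathscr C\,\mathrm{mod}\,\omega_1)<\infty$.
   Context: $\mathrm{VC}(\mathscr C\,\mathrm{mod}\,\omega_1)$ is the supremum of $n$ for which there exist uncountable sets $A_1,\dots,A_n\subseteq\Omega$ such that for every $J\subseteq\{1,\dots,n\}$ some $C\in\mathscr C$ contains $A_i$ for all $i\in J$ and is disjoint from $A_j$ for all $j\notin J$. A learning rule for $\mathscr C$ under a family $\mathcal P$ of probability measures is a map $\mathcal L:\bigcup_n\Omega^n\times\{0,1\}^n\to\mathscr C$ such that $\sigma\mapsto\mu(\mathcal L(\sigma,C\cap\sigma)\triangle C)$ is $\mu^{\otimes n}$-measurable for all $C\in\mathscr C,\mu\in\mathcal P,n$; it is PAC under $\mathcal P$ if for every $\varepsilon>0$, $\sup_{\mu\in\mathcal P}\sup_{C\in\mathscr C}\mu^{\otimes n}\{\sigma:\mu(\mathcal L(\sigma,C\cap\sigma)\triangle C)>\varepsilon\}\to0$ as $n\to\infty$; $\mathscr C$ is PAC learnable under $\mathcal P$ if a PAC rule exists. A measure is non-atomic if every set of positive measure contains a subset of strictly smaller positive measure. *)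

(* Defs.v *)
From HB Require Import structures.
From mathcomp Require Import all_boot all_order all_algebra.
From mathcomp Require Import all_classical all_reals all_analysis.
From mathcomp Require Import measurable_realfun.

Set Implicit Arguments.
Unset Strict Implicit.
Unset Printing Implicit Defensive.

Import Order.TTheory GRing.Theory Num.Theory.
Local Open Scope classical_set_scope.
Local Open Scope ring_scope.

Section Defs.
Variable R : realType.

Definition is_metric (P : Type) (dist : P -> P -> R) : Prop :=
  [/\ (forall x y, 0 <= dist x y),
      (forall x y, dist x y = 0 <-> x = y),
      (forall x y, dist x y = dist y x) &
      (forall x y z, dist x z <= dist x y + dist y z)].

Definition metric_separable (P : Type) (dist : P -> P -> R) : Prop :=
  exists D : set P, countable D /\
    forall x e, 0 < e -> exists2 y, D y & dist x y < e.

Definition metric_complete (P : Type) (dist : P -> P -> R) : Prop :=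
  forall u : nat -> P,
    (forall e, 0 < e -> exists N, forall m n, (N <= m)%N -> (N <= n)%N ->
        dist (u m) (u n) < e) ->
    exists l, forall e, 0 < e -> exists N, forall n, (N <= n)%N -> dist (u n) l < e.

Definition metric_open (P : Type) (dist : P -> P -> R) (U : set P) : Prop :=
  forall x, U x -> exists2 e, 0 < e & [set y | dist x y < e] `<=` U.

Definition polish_metric (P : Type) (dist : P -> P -> R) : Prop :=
  [/\ is_metric dist, metric_separable dist & metric_complete dist].

Definition standard_borel d (T : measurableType d) : Prop :=
  exists (P : Type) (dist : P -> P -> R) (phi : T -> P),
    [/\ polish_metric dist, bijective phi &
        forall A : set T, measurable A <-> <<s metric_open dist >> (phi @` A)].

Local Open Scope ereal_scope.

Definition nonatomic d (T : measurableType d) (mu : set T -> \bar R) : Prop :=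
  forall A, measurable A -> 0 < mu A ->
    exists B, [/\ measurable B, B `<=` A & 0 < mu B < mu A].

(* the n-fold product measure mu^{(x)n} on n.-tuple T (with the product
   sigma-algebra of the library), defined by iterated integration:
   mu^{(x)(n+1)}(A) = \int mu^{(x)n}({t | x :: t \in A}) dmu(x). *)
Section prod_meas.
Context d (T : measurableType d) (mu : set T -> \bar R).
Fixpoint prod_meas (n : nat) : set (n.-tuple T) -> \bar R :=
  match n as m return set (m.-tuple T) -> \bar R with
  | 0 => fun A => if `[< A [tuple] >] then 1 else 0
  | m.+1 => fun A =>
      \int[mu]_x @prod_meas m [set t : m.-tuple T | A (cons_tuple x t)]
  end.
End prod_meas.
Arguments prod_meas {d T} mu n _.

(* outer measure of mu^{(x)n}; on mu^{(x)n}-measurable sets it is the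
   completed product measure *)
Definition prod_outer d (T : measurableType d) (mu : set T -> \bar R) (n : nat)
  (S : set (n.-tuple T)) : \bar R :=
  ereal_inf [set prod_meas mu n A | A in [set A | measurable A /\ S `<=` A]].

Definition prod_completion_measurable d (T : measurableType d)
  (mu : set T -> \bar R) (n : nat) (f : n.-tuple T -> \bar R) : Prop :=
  exists g : n.-tuple T -> \bar R, exists N : set (n.-tuple T),
    [/\ measurable_fun [set: n.-tuple T] g, measurable N, prod_meas mu n N = 0 &
        [set s | f s <> g s] `<=` N].

Definition labelling (T : Type) (n : nat) (C : set T) (s : n.-tuple T)
  : n.-tuple bool := map_tuple (fun x => `[< C x >]) s.

Definition lr_error d (T : measurableType d) (mu : set T -> \bar R)
  (L : forall n : nat, n.-tuple T -> n.-tuple bool -> set T)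
  (C : set T) (n : nat) (s : n.-tuple T) : \bar R :=
  mu (L n s (labelling C s) `+` C).

Definition is_learning_rule d (T : measurableType d)
  (cls : set (set T)) (Pf : probability T R -> Prop)
  (L : forall n : nat, n.-tuple T -> n.-tuple bool -> set T) : Prop :=
  (forall n s lab, cls (L n s lab)) /\
  (forall (C : set T) (mu : probability T R) (n : nat), cls C -> Pf mu ->
     prod_completion_measurable mu (@lr_error d T mu L C n)).

Definition is_PAC d (T : measurableType d)
  (cls : set (set T)) (Pf : probability T R -> Prop)
  (L : forall n : nat, n.-tuple T -> n.-tuple bool -> set T) : Prop :=
  forall eps : R, (0 < eps)%R -> forall delta : R, (0 < delta)%R ->
    exists N : nat, forall n : nat, (N <= n)%N ->
      forall (mu : probability T R) (C : set T), Pf mu -> cls C ->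
        prod_outer mu [set s : n.-tuple T | lr_error mu L C s > eps%:E]
          <= delta%:E.

Definition PAC_learnable d (T : measurableType d)
  (cls : set (set T)) (Pf : probability T R -> Prop) : Prop :=
  exists L, is_learning_rule cls Pf L /\ is_PAC cls Pf L.

End Defs.

Definition shatters_uncountable (T : Type) (cls : set (set T)) (n : nat) : Prop :=
  exists A : 'I_n -> set T,
    (forall i, ~ countable (A i)) /\
    forall J : 'I_n -> bool, exists C, cls C /\
      forall i, (J i -> A i `<=` C) /\ (~~ J i -> A i `&` C = set0).

Definition VC_mod_omega1_finite (T : Type) (cls : set (set T)) : Prop :=
  exists N : nat, forall n, shatters_uncountable cls n -> (n <= N)%N.

(* Main.v *)
Require Import Defs.
From HB Require Import structures.
From mathcomp Require Import all_boot all_order all_algebra.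
From mathcomp Require Import all_classical all_reals all_analysis.
From mathcomp Require Import measurable_realfun.
From mathcomp Require Import lra zify.

Set Implicit Arguments.
Unset Strict Implicit.
Unset Printing Implicit Defensive.

Import Order.TTheory GRing.Theory Num.Theory.
Local Open Scope classical_set_scope.
Local Open Scope ring_scope.

(** Suppose [m] examples suffice for accuracy and confidence [1/16], and that
    [n > 2m] uncountable sets [A i] are shattered by concepts [C J]. Each [A i]
    lies in the Borel set [B i], the intersection of the [C J] with [J i] and of
    the complements of the other [C J]; the [B i] are pairwise disjoint and
    shattered by the same concepts. Being Borel, hence analytic, and
    uncountable, each [B i] contains an injective image of a Cantor scheme, and
    transporting Lebesgue measure gives a non-atomic probability [mu] with
    [mu (B i) = 1/n] for all [i]. A sample of size [m] misses at least half of
    the [B i]. On a missed [B i] the rule gives the same answer for [J] and for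
    [J] flipped at [i], while [C J] and its flip are complementary there, so for
    every sample the error averaged over [J] is at least [1/4]. As this holds
    for every sample, it can be integrated against measurable covers of the
    failure sets, without measurability of the rule. *)

(** * Analytic sets *)

Lemma invSn_lt (R : realType) (e : R) : 0 < e -> exists n : nat, n.+1%:R^-1 < e.
Proof.
move=> e0; exists (Num.truncn e^-1).
by rewrite invf_plt ?posrE// truncnS_gt.
Qed.

Lemma sub_countable_set (T : Type) (A B : set T) :
  A `<=` B -> countable B -> countable A.
Proof. by move=> AB; apply: sub_countable; exact: subset_card_le. Qed.

Section analytic.
Variables (R : realType) (T : Type) (dist : T -> T -> R).
Implicit Types (A : set T) (D W : set (T * (nat -> nat))).

(* Closed in the product of [T] with the Baire space [nat -> nat]. *)
Definition baire_closed D := forall p s, ~ D (p, s) ->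
  exists2 e, 0 < e & exists k, forall q t, dist p q < e ->
    (forall i, (i < k)%N -> t i = s i) -> ~ D (q, t).

Definition analytic A := exists D, baire_closed D /\ A = fst @` D.

Lemma analytic_closed A : metric_open dist (~` A) -> analytic A.
Proof.
move=> oA; exists [set u | A u.1]; split.
  move=> p s /oA [e e0 be]; exists e => //; exists 0%N => q t pq _.
  exact: be.
apply/seteqP; split => [p Ap|_ [[p s] Ap <-]//].
by exists (p, fun=> 0%N).
Qed.

(** The first entry of the Baire sequence names a member of the union; the tail is the witness for
    that member. *)
Lemma analytic_bigcup (A : nat -> set T) :
  (forall n, analytic (A n)) -> analytic (\bigcup_n A n).
Proof.
move=> h; have [D hD] := choice h; have cD n := (hD n).1; have AE n := (hD n).2.
exists [set u | D (u.2 0%N) (u.1, fun i => u.2 i.+1)]; split.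
  move=> p s /= nD; have [e e0 [k hk]] := cD _ _ _ nD; exists e => //; exists k.+1 => q t pq ts.
  by rewrite ts//; apply: hk => // i ik; rewrite ts.
apply/seteqP; split=> [p [n _]|_ [[p s] /= Dp <-]].
  rewrite AE => -[[q s] Ds /= <-].
  by exists (q, fun i => if i is j.+1 then s j else n).
by exists (s 0%N) => //; rewrite AE; exists (p, fun i => s i.+1).
Qed.

(** A single sequence interleaves witnesses for all the sets, through the pairing [pickle]. *)
Lemma analytic_bigcap (A : nat -> set T) :
  (forall n, analytic (A n)) -> analytic (\bigcap_n A n).
Proof.
move=> h; have [D hD] := choice h; have cD n := (hD n).1; have AE n := (hD n).2.
exists [set u | forall n, D n (u.1, fun i => u.2 (pickle (n, i)))]; split.
  move=> p s /= /existsNP[n nD]; have [e e0 [k hk]] := cD _ _ _ nD; exists e => //.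
  (* Agreement below this index covers the first [k] entries of the [n]-th interleaved witness. *)
  exists (\max_(i < k) (pickle (n, val i)).+1)%N => q t pq ts /(_ n).
  apply: hk => // i ik; apply: ts.
  exact: (@leq_bigmax _ (fun i : 'I_k => (pickle (n, val i)).+1) (Ordinal ik)).
apply/seteqP; split=> [p Ap|_ [[p s] /= Dp <-] n _]; last first.
  by rewrite AE; exists (p, fun i => s (pickle (n, i))).
have /choice[s Ds] : forall n, exists s, D n (p, s).
  by move=> n; have := Ap n Logic.I; rewrite AE => -[[q s] Ds /= <-]; exists s.
exists (p, fun j => if @unpickle (nat * nat)%type j is Some ni then s ni.1 ni.2 else 0%N) => //= n.
rewrite [X in D n (_, X)](_ : _ = s n)//.
by apply/funext => i; rewrite pickleK.
Qed.

Hypothesis Hd : is_metric dist.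

Lemma dist_xx x : dist x x = 0.
Proof. by case: Hd => _ h _ _; exact/h. Qed.

(** An open set is the countable union of the closed sets of points at distance at least
    [n.+1%:R^-1] from its complement. *)
Lemma analytic_open A : metric_open dist A -> analytic A.
Proof.
case: Hd => d0 _ dC dtri oA.
rewrite (_ : A = \bigcup_n [set x | forall y, ~ A y -> n.+1%:R^-1 <= dist x y]).
  apply: analytic_bigcup => n; apply: analytic_closed => x /= /existsNP[y].
  move=> /not_implyP[nAy] /negP; rewrite -ltNge => xy.
  exists (n.+1%:R^-1 - dist x y); first by rewrite subr_gt0.
  move=> z /= xz /(_ y nAy); apply/negP; rewrite -ltNge.
  by apply: le_lt_trans (dtri z x y) _; rewrite dC -ltrBrDr.
apply/seteqP; split=> [x Ax|x [n _ /= h]].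
  have [e e0 xe] := oA x Ax; have [n ne] := invSn_lt e0.
  exists n => // y nAy; rewrite leNgt; apply/negP => xy.
  by apply: nAy; apply: xe => /=; exact: lt_trans ne.
by apply: contrapT => /h; rewrite dist_xx; apply/negP; rewrite -ltNge.
Qed.

(** The sets that are analytic together with their complements form a sigma-algebra containing the
    open sets. *)
Lemma borel_analytic A : <<s metric_open dist >> A -> analytic A.
Proof.
move=> bA; suff : [set A | analytic A /\ analytic (~` A)] A by case.
move: A bA; apply: smallest_sub => [|A oA].
  split=> /=.
  - by split; apply: analytic_closed; rewrite ?setC0 ?setCT => x //= _; exists 1.
  - by move=> A [a b]; rewrite setTD setCK.
  - move=> A h; split; first by apply: analytic_bigcup => n; have [] := h n.
    rewrite setC_bigcup; apply: analytic_bigcap => n; by have [] := h n.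
split; first exact: analytic_open.
by apply: analytic_closed; rewrite setCK.
Qed.

Hypothesis Hsep : metric_separable dist.

(** Size is measured after projection, so that splitting produces distinct points of [T] and not
    merely distinct Baire coordinates. *)
Let uncountable W := ~ countable (fst @` W).

Lemma uncountable_piece (I : Type) (E : set I) (F : I -> set (T * (nat -> nat))) W :
  countable E -> W `<=` \bigcup_(i in E) F i -> uncountable W ->
  exists2 i, E i & uncountable (W `&` F i).
Proof.
move=> cE WF uW; apply: contrapT => h; apply: uW.
apply: (@sub_countable_set _ _ (\bigcup_(i in E) (fst @` (W `&` F i)))).
  by move=> _ [u Wu <-]; have [i Ei Fi] := WF _ Wu; exists i => //; exists u.
apply: bigcup_countable => // i Ei; apply: contrapT => ui.
by apply: h; exists i.
Qed.

(** Non-condensation points of the projection lie in one of countably many small balls, centred in a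
    dense set, whose part is countable. Their union [N] is countable, so at least two points remain
    outside it. *)
Lemma two_condensation_points W : uncountable W -> exists x y, x <> y /\
  forall z, z = x \/ z = y ->
  forall r, 0 < r -> uncountable (W `&` [set u | dist z u.1 < r]).
Proof.
case: Hd => d0 deq dC dtri uW; case: Hsep => S [cS dS].
pose F (i : T * nat) := [set u : T * (nat -> nat) | dist i.1 u.1 < i.2.+1%:R^-1].
pose E := [set i : T * nat | S i.1 /\ countable (fst @` (W `&` F i))].
have cE : countable E.
  apply: (@sub_countable_set _ _ (S `*` setT)); first by move=> i [].
  exact: countableX.
pose N := \bigcup_(i in E) (fst @` (W `&` F i)).
have cN : countable N by apply: bigcup_countable => // i [].
have cond z : ~ N z -> (fst @` W) z -> 
    forall r, 0 < r -> uncountable (W `&` [set u | dist z u.1 < r]).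
  move=> nNz [u Wu uz] r r0 cr; apply: nNz.
  have [n nr] := @invSn_lt _ (r / 2) ltac:(lra).
  have [y Sy zy] := dS z n.+1%:R^-1 ltac:(by rewrite invr_gt0).
  exists (y, n); last by exists u => //; split => //; rewrite /F/= uz dC.
  split => //=; apply: sub_countable_set cr => _ [v [Wv /= yv] <-].
  exists v => //; split => //=; apply: le_lt_trans (dtri z y v.1) _.
  by rewrite (splitr r) ltrD// (lt_trans _ nr).
have [x [Wx nNx]] : exists x, (fst @` W) x /\ ~ N x.
  apply: contrapT => h; apply: uW; apply: sub_countable_set cN => x Wx.
  by apply: contrapT => nNx; apply: h; exists x.
have [y [yx [Wy nNy]]] : exists y, y <> x /\ (fst @` W) y /\ ~ N y.
  apply: contrapT => h; apply: uW.
  apply: (@sub_countable_set _ _ (\bigcup_(b in [set: bool]) if b then N else [set x])).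
    move=> y Wy; have [yx|yx] := pselect (y = x); first by exists false.
    by exists true => //; apply: contrapT => nNy; apply: h; exists y.
  apply: bigcup_countable => // -[] _; [exact: cN|exact: countable1].
by exists x, y; split=> [/esym//|z [->|->]]; exact: cond.
Qed.

Definition baire_small k (e : R) W := forall u v, W u -> W v ->
  dist u.1 v.1 <= e /\ forall i, (i < k)%N -> u.2 i = v.2 i.

(** The two halves are taken in small disjoint balls around two condensation points. *)
Lemma uncountable_split k (e : R) W : 0 < e -> uncountable W ->
  exists W' : bool -> set (T * (nat -> nat)),
  [/\ forall b, W' b `<=` W, forall b, uncountable (W' b),
      forall b, baire_small k e (W' b) &
      exists2 r, 0 < r & forall u v, W' false u -> W' true v -> r <= dist u.1 v.1].
Proof.
case: Hd => d0 deq dC dtri e0 /two_condensation_points[x [y [xy cxy]]].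
have dxy : 0 < dist x y.
  by rewrite lt_neqAle d0 andbT eq_sym; apply/eqP => /deq.
(* The first bound gives diameter at most [e]; the second leaves a gap of at least [2 * r] between
   the two balls. *)
pose r := Num.min (e / 2) (dist x y / 4).
have r0 : 0 < r by rewrite lt_min !divr_gt0.
have piece z : z = x \/ z = y -> exists W', [/\ W' `<=` W, uncountable W',
    baire_small k e W' & forall u, W' u -> dist z u.1 < r].
  (* There are countably many prefixes of length [k], so one of them keeps an uncountable part of
     the ball. *)
  move=> /cxy/(_ r r0)/(@uncountable_piece _ setT
    (fun s => [set u | mkseq u.2 k = s])) [//|u _|s _ us].
    by exists (mkseq u.2 k).
  eexists; split; [|exact: us| |].
  - by move=> u [[]].
  - move=> u v [[_ /= zu] us'] [[_ /= zv] vs]; split.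
      have := dtri u.1 z v.1; rewrite (dC _ z).
      have : r <= e / 2 by rewrite ge_min lexx.
      lra.
    move=> i ik; have := congr1 (fun s => nth 0%N s i) (etrans us' (esym vs)).
    by rewrite !nth_mkseq.
  - by move=> u [[]].
have [W0 [W0W u0 s0 x0]] := piece x (or_introl erefl).
have [W1 [W1W u1 s1 x1]] := piece y (or_intror erefl).
exists (fun b => if b then W1 else W0); split; [by case|by case|by case|].
exists r => // u v /x0 xu /x1 yv.
have := dtri x u.1 y; have := dtri u.1 v.1 y; rewrite (dC v.1 y).
have : r <= dist x y / 4 by rewrite ge_min lexx orbT.
lra.
Qed.

End analytic.

(** * Cantor schemes *)

Section dyadic.
Variable R : realType.
Implicit Types x y : R.

(** For [x >= 0], the index of the dyadic interval of length [2^-n] that contains [x]. *)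
Definition dyadic n x := Num.truncn (2 ^+ n * x).

Lemma half_dyadicS n x : (dyadic n.+1 x)./2 = dyadic n x.
Proof.
rewrite /dyadic exprS -mulrA; move: (2 ^+ n * x) => {n}y.
have [y0|y0] := leP 0 y; last first.
  by rewrite !truncn_floor !leNgt y0 pmulr_rlt0// y0.
have /andP[a b] : (Num.truncn (2 * y))%:R <= 2 * y < (Num.truncn (2 * y)).+1%:R.
  by rewrite truncn_itv// mulr_ge0.
apply/esym/truncn_def; move: a b; move: (Num.truncn _) => a.
rewrite -{1 2}(odd_double_half a) -mul2n => h1 h2; apply/andP; split.
  have : (2 * a./2)%:R <= 2 * y by apply: le_trans h1; rewrite ler_nat leq_addl.
  by rewrite natrM ler_pM2l.
have : 2 * y < (2 * (a./2.+1))%:R.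
  by apply: lt_le_trans h2 _; rewrite ler_nat; case: (odd a) => /=; lia.
by rewrite natrM ltr_pM2l.
Qed.

(** Points in a common dyadic interval of level [n] are less than [2^-n] apart, and
    [2^-n <= 1/(n+1)]. *)
Lemma dyadic_inj x y : 0 <= x -> 0 <= y ->
  (forall n, dyadic n x = dyadic n y) -> x = y.
Proof.
move=> x0 y0 xy; apply: contrapT => /eqP; rewrite -subr_eq0 -normr_gt0.
move=> /invSn_lt[n nxy].
have p0 : 0 < (2 : R) ^+ n by rewrite exprn_gt0.
have : `|2 ^+ n * x - 2 ^+ n * y| < 1.
  have := xy n; rewrite /dyadic => e.
  have := @truncn_itv _ (2 ^+ n * x) (mulr_ge0 (ltW p0) x0).
  have := @truncn_itv _ (2 ^+ n * y) (mulr_ge0 (ltW p0) y0).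
  rewrite e -natr1; move: (_ * x) (_ * y) => a b; rewrite ltr_norml.
  lra.
rewrite -mulrBr normrM (ger0_norm (ltW p0)); apply/negP; rewrite -leNgt.
rewrite -ler_pdivrMl// mulr1 ltW// (le_lt_trans _ nxy)//.
by rewrite lef_pV2 ?posrE// -natrX ler_nat ltn_expl.
Qed.

Lemma measurable_dyadic n k : measurable [set x : measurableTypeR R | dyadic n x = k].
Proof.
have p0 : 0 < (2 : R) ^+ n by rewrite exprn_gt0.
have mle j : measurable [set x : measurableTypeR R | (dyadic n x <= j)%N].
  rewrite (_ : [set _ | _] = [set` `]-oo, (j.+1%:R / 2 ^+ n)[]); first exact: measurable_itv.
  by apply/seteqP; split => x /=; rewrite in_itv/= /dyadic truncn_le_nat ltr_pdivlMr// mulrC.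
case: k => [|k].
  rewrite (_ : [set _ | _] = [set x | (dyadic n x <= 0)%N])//.
  by apply/seteqP; split => x /=; rewrite leqn0 => /eqP.
rewrite (_ : [set _ | _] = [set x | (dyadic n x <= k.+1)%N] `\` [set x | (dyadic n x <= k)%N]).
  exact: measurableD.
by apply/seteqP; split => x /=; lia.
Qed.

End dyadic.

Section cantor_scheme.
Variables (R : realType) (T : Type) (dist : T -> T -> R).
Hypothesis Hd : polish_metric dist.

(* Negative reals have truncation [0] and are all sent to one point, whence
   the sign hypotheses in the injectivity clause. *)
Lemma cantor_map (B : nat -> set T) :
  (forall k, analytic dist (B k)) -> (forall k, ~ countable (B k)) ->
  exists G : measurableTypeR R -> T,
  [/\ forall x, B (Num.truncn x) (G x),
      forall x y, 0 <= x -> 0 <= y -> Num.truncn x = Num.truncn y ->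
        G x = G y -> x = y &
      forall U, metric_open dist U -> measurable (G @^-1` U)].
Proof.
move=> aB uB; case: Hd => md sep compl; case: (md) => d0 deq dC dtri.
have [D hD] := choice aB; have cD k := (hD k).1; have BE k := (hD k).2.
have /choice[S hS] : forall nW : nat * set (T * (nat -> nat)),
    exists W' : bool -> set (T * (nat -> nat)), ~ countable (fst @` nW.2) ->
  [/\ forall b, W' b `<=` nW.2, forall b, ~ countable (fst @` (W' b)),
      forall b, baire_small dist nW.1.+1 nW.1.+1%:R^-1 (W' b) &
      exists2 r, 0 < r & forall u v, W' false u -> W' true v -> r <= dist u.1 v.1].
  move=> [n W]; have [uW|uW] := pselect (countable (fst @` W)).
    (* A dummy value: every piece of the scheme below is uncountable. *)
    by exists (fun=> set0).
  have n0 : 0 < n.+1%:R^-1 :> R by rewrite invr_gt0.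
  by have [W' h] := uncountable_split md sep n.+1 n0 uW; exists W'.
(* [W n k] lives over the dyadic interval [k 2^-n, (k+1) 2^-n[, whose parent
   at level [n - 1] has index [k./2]. *)
pose W := fix W n k := if n is m.+1 then S (m, W m k./2) (odd k) else D k.
have uW n k : ~ countable (fst @` W n k).
  elim: n k => [k|n IH k] /=; first by rewrite -BE.
  by have [_ + _ _] := hS (n, W n k./2) (IH _); exact.
have WS n k : W n.+1 k `<=` W n k./2.
  by have [+ _ _ _] := hS (n, W n k./2) (uW _ _); exact.
have Wsmall n k : baire_small dist n.+1 n.+1%:R^-1 (W n.+1 k).
  by have [_ _ + _] := hS (n, W n k./2) (uW _ _); exact.
have Wsep n k k' : k./2 = k'./2 -> k <> k' -> exists2 r, 0 < r &
    forall u v, W n.+1 k u -> W n.+1 k' v -> r <= dist u.1 v.1.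
  move=> kk' nk; have [_ _ _ [r r0 hr]] := hS (n, W n k./2) (uW _ _).
  have oo : odd k != odd k'.
    apply/eqP => o; apply: nk.
    by rewrite -(odd_double_half k) -(odd_double_half k') o kk'.
  exists r => //= u v; rewrite -kk'; move: oo.
  case: (odd k) (odd k') => -[] //= _ Wu Wv; last exact: hr.
  by rewrite dC; exact: hr.
have /choice[u hu] : forall nk : nat * nat, exists u, W nk.1 nk.2 u.
  move=> [n k] /=; apply: contrapT => h; apply: (uW n k).
  apply: sub_countable_set (countable0 T) => z [v Wv _].
  by apply: h; exists v.
pose a (x : R) n := u (n, dyadic n x).
have Wa x n m : (n <= m)%N -> W n (dyadic n x) (a x m).
  move=> /subnKC <-; move: (m - n)%N => j; elim: j n => [|j IH] n.
    by rewrite addn0; exact: (hu (n, dyadic n x)).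
  by rewrite -half_dyadicS; apply: WS; rewrite addnS -addSn; exact: IH.
have /choice[G hG] : forall x : R, exists l, forall e, 0 < e ->
    exists N, forall n, (N <= n)%N -> dist (a x n).1 l < e.
  move=> x; apply: compl => e /invSn_lt[n ne]; exists n.+1 => m k nm nk.
  by have [/le_lt_trans->] := Wsmall _ _ _ _ (Wa x _ _ nm) (Wa x _ _ nk).
(* [G x] is a limit of points of the piece and need not project from it, hence the non-strict
   bound. *)
have WG x n v : W n.+1 (dyadic n.+1 x) v -> dist v.1 (G x) <= n.+1%:R^-1.
  move=> Wv; apply/ler_addgt0Pr => e /(hG x)[N hN].
  apply: le_trans (dtri _ (a x (maxn N n.+1)).1 _) _.
  apply: lerD; last by rewrite ltW// hN// leq_maxl.
  by have [] := Wsmall _ _ _ _ Wv (Wa x _ _ (leq_maxr N n.+1)).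
exists G; split.
(* Pieces of level [i.+1] fix entry [i], so this diagonal is the limit of the Baire coordinates. All
   the [a x m] lie in the closed set [D (Num.truncn x)], hence so does the limit. *)
- move=> x; rewrite BE; exists (G x, fun i => (a x i.+1).2 i) => //.
  apply: contrapT => /cD[e e0 [k hk]]; have [N hN] := hG x e e0.
  pose m := maxn N k.
  apply: (hk (a x m).1 (a x m).2); first by rewrite dC hN// leq_maxl.
    move=> i ik; have [|_ ->//] := Wsmall _ _ _ _ (Wa x _ m _) (Wa x _ i.+1 (leqnn _)).
    by rewrite (leq_trans ik)// leq_maxr.
  rewrite -surjective_pairing.
  by have := Wa x 0%N m isT; rewrite /dyadic expr0 mul1r.
- move=> x y x0 y0 xy Gxy; apply: dyadic_inj => //; elim=> [|n IH].
    by rewrite /dyadic expr0 !mul1r.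
  apply: contrapT => ne.
  have [|r r0 hr] := Wsep n _ _ _ ne; first by rewrite !half_dyadicS.
  have [N hN] := hG x (r / 2) ltac:(lra); have [M hM] := hG y (r / 2) ltac:(lra).
  pose m := maxn n.+1 (maxn N M).
  have := hr _ _ (Wa x _ m (leq_maxl _ _)) (Wa y _ m (leq_maxl _ _)).
  have := hN m ltac:(rewrite /m; lia); have := hM m ltac:(rewrite /m; lia).
  have := dtri (a x m).1 (G x) (a y m).1; rewrite Gxy (dC (G y)); lra.
- move=> U oU.
  (* By [WG], [G] maps the whole dyadic set of index [k] into this closed ball, so the preimage of
     [U] is a countable union of dyadic sets. *)
  pose P n k := forall z, dist (u (n.+1, k)).1 z <= n.+1%:R^-1 -> U z.
  rewrite (_ : _ @^-1` _ = \bigcup_n \bigcup_(k in P n) [set x | dyadic n.+1 x = k]).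
    apply: bigcup_measurable => n _; apply: bigcup_measurable => k _.
    exact: measurable_dyadic.
  apply/seteqP; split=> [x /oU[e e0 be]|x [n _ [k Pk xk]]].
    have [n ne] := @invSn_lt _ (e / 2) ltac:(lra).
    exists n => //; exists (dyadic n.+1 x) => // z hz; apply: be => /=.
    apply: le_lt_trans (dtri _ (a x n.+1).1 _) _; rewrite dC (splitr e).
    by rewrite ltrD// (le_lt_trans _ ne)// WG//; exact: Wa.
  by apply: Pk; rewrite -xk; apply: WG; exact: (Wa x n.+1 n.+1).
Qed.

End cantor_scheme.

(** * Non-atomic measures on uncountable Borel sets *)

Section nonatomic_measures.
Context (R : realType) d (T : measurableType d) (dist : T -> T -> R).
Hypothesis Hd : polish_metric dist.
Hypothesis Hm : forall A : set T, measurable A <-> <<s metric_open dist >> A.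

Lemma open_measurable_metric U : metric_open dist U -> measurable U.
Proof. by move=> oU; apply/Hm; exact: sub_sigma_algebra. Qed.

Lemma metric_open_ball x (e : R) : metric_open dist [set y | dist x y < e].
Proof.
case: Hd => -[_ _ dC dtri] _ _ y /= xy.
exists (e - dist x y); first by rewrite subr_gt0.
by move=> z /= yz; apply: le_lt_trans (dtri x y z) _; rewrite addrC -ltrBrDr.
Qed.

Lemma measurable_point (x : T) : measurable [set x].
Proof.
case: Hd => -[d0 deq dC dtri] _ _; rewrite -(setCK [set x]).
apply/measurableC/open_measurable_metric => y /= yx.
have yx0 : 0 < dist y x.
  by rewrite lt_neqAle d0 andbT eq_sym; apply/eqP => /deq.
by exists (dist y x) => // z /= + zx; rewrite zx ltxx.
Qed.

(** Separability makes an atom concentrate on arbitrarily small balls, hence on one point. *)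
Lemma nonatomic_null_points (mu : probability T R) :
  (forall t, mu [set t] = 0%E) -> nonatomic mu.
Proof.
case: Hd => -[d0 deq dC dtri] [S [cS dS]] _ mu0 A mA muA; apply: contrapT => noB.
have mball x e := open_measurable_metric (@metric_open_ball x e).
have alt C : measurable C -> C `<=` A -> mu.-negligible C \/ mu.-negligible (A `\` C).
  move=> mC CA; have [C0|C0] := eqVneq (mu C) 0%E.
    by left; exists C; split.
  right; exists (A `\` C); split => //; first exact: measurableD.
  have muC : (mu C = mu A)%E.
    apply/eqP; rewrite eq_le le_measure ?inE//= leNgt; apply/negP => CA'.
    by apply: noB; exists C; split => //; rewrite CA' andbT lt0e C0 measure_ge0.
  rewrite measureD//; last by rewrite ltey_eq fin_num_measure.
  by rewrite (setIidr CA) [X in (_ - X)%E]muC subee// fin_num_measure.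
have nA : ~ mu.-negligible A.
  by move=> /(measure_negligible mA) A0; move: muA; rewrite A0 ltxx.
have [f finj] := countable_injP _ cS.
(* Otherwise [alt] makes each of the countably many balls centred in [S] null within [A], and these
   cover [A]. The injection [f] numbers the centres. *)
have big (n : nat) : exists x, mu.-negligible (A `\` [set y | dist x y < n.+1%:R^-1]).
  apply: contrapT => h; apply: nA.
  apply: (@negligibleS _ _ _ _ (\bigcup_k [set y | A y /\
      exists x, [/\ S x, f x = k & dist x y < n.+1%:R^-1]])).
    move=> y Ay; have [x Sx yx] := dS y n.+1%:R^-1 ltac:(by rewrite invr_gt0).
    by exists (f x) => //; split => //; exists x; rewrite dC.
  apply: negligible_bigcup => k.
  have [[x [Sx fx]]|nx] := pselect (exists x, S x /\ f x = k); last first.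
    apply: negligibleS (negligible_set0 mu) => y [_ [x [Sx fx _]]].
    by apply: nx; exists x.
  apply: (@negligibleS _ _ _ _ (A `&` [set y | dist x y < n.+1%:R^-1])).
    move=> y [Ay [x' [Sx' fx' xy]]]; split => //=.
    by rewrite (finj x x') ?inE// fx fx'.
  have [//|] := alt (A `&` [set y | dist x y < n.+1%:R^-1])
    (measurableI _ _ mA (mball _ _)) (@subIsetl _ _ _).
  by rewrite setDIr setDv set0U => hx; exfalso; apply: h; exists x.
(* Up to a null set [A] lies in balls of radius tending to [0], hence in a
   single point. *)
have [g hg] := choice big; apply: nA.
apply: (@negligibleS _ _ _ _ ((\bigcup_n (A `\` [set y | dist (g n) y < n.+1%:R^-1]))
  `|` \bigcap_n [set y | dist (g n) y < n.+1%:R^-1])).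
  move=> y Ay; have [h|/existsNP[n hn]] :=
    pselect (forall n, dist (g n) y < n.+1%:R^-1); [right|left].
    by move=> n _; exact: h.
  by exists n.
apply: negligibleU; first exact: negligible_bigcup.
have [[y hy]|ny] := pselect (exists y, forall n, dist (g n) y < n.+1%:R^-1); last first.
  apply: negligibleS (negligible_set0 mu) => y hy; apply: ny; exists y => n.
  exact: hy.
apply: (@negligibleS _ _ _ _ [set y]); last first.
  by exists [set y]; split; [exact: measurable_point|exact: mu0|].
move=> z hz /=; apply/deq/eqP; rewrite eq_le d0 andbT; apply/ler_addgt0Pr => e e0.
have [n ne] := @invSn_lt _ (e / 2) ltac:(lra).
rewrite add0r (le_trans (dtri z (g n) y))// (splitr e) lerD// ltW//.
  by rewrite dC (lt_trans (hz n Logic.I)).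
by rewrite (lt_trans (hy n)).
Qed.

(** The measure is the image under [G] of the uniform law on [[0, N+1]]: [G] sends [[k, k+1[], of
    mass [1/(N+1)], into [B k]. *)
Lemma nonatomic_spread (B : nat -> set T) (N : nat) :
  (forall k, measurable (B k)) -> (forall k, ~ countable (B k)) ->
  exists mu : probability T R, nonatomic mu /\
    forall k, (k <= N)%N -> (N.+1%:R^-1%:E <= mu (B k))%E.
Proof.
move=> mB uB; case: (Hd) => md _ _.
have aB k : analytic dist (B k) by apply: borel_analytic => //; exact/Hm.
have [G [BG Ginj oG]] := cantor_map Hd aB uB.
have mG : measurable_fun setT G.
  apply: (measurability (metric_open dist)).
    by apply/seteqP; split=> A /Hm.
  by move=> _ [U oU <-]; rewrite setTI; exact: oG.
have N0 : 0 < N.+1%:R :> R by [].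
pose G' : {mfun measurableTypeR R >-> T} :=
  HB.pack_for {mfun measurableTypeR R >-> T} G (isMeasurableFun.Build _ _ _ _ G mG).
pose mu : probability T R := distribution (uniform_prob N0) G'.
have muE A : mu A = uniform_prob N0 (G @^-1` A) by [].
exists mu; split.
  apply: nonatomic_null_points => t; rewrite muE /uniform_prob integral_uniform_pdf.
  (* A fibre has at most one nonnegative point for each value of [Num.truncn], so it is Lebesgue
     null on the support. *)
  have ct : countable (G @^-1` [set t] `&` `[0, N.+1%:R]).
    apply: (@sub_countable_set _ _ (\bigcup_k [set x : R | [/\ 0 <= x, Num.truncn x = k & G x = t]])).
      by move=> x [/= Gx]; rewrite in_itv/= => /andP[x0 _]; exists (Num.truncn x).
    apply: bigcup_countable => // k _.
    have [[x [x0 xk Gx]]|nx] := pselect (exists x, [/\ 0 <= x, Num.truncn x = k & G x = t]).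
      apply: sub_countable_set (countable1 x) => y [y0 yk Gy] /=.
      by apply: Ginj => //; rewrite ?yk ?xk ?Gy ?Gx.
    by apply: sub_countable_set (countable0 _) => y hy; apply: nx; exists y.
  apply: (null_content_dominatesP _ _).1 (dominates_uniform_prob N0) _ _ _.
    exact: countable_measurable (@measurable_set1 R) ct.
  exact: countable_lebesgue_measure0.
move=> k kN; rewrite muE.
have kk1 : k%:R < k.+1%:R :> R by rewrite ltr_nat.
apply: (@le_trans _ _ (uniform_prob N0 `[k%:R, k.+1%:R[)).
  rewrite /uniform_prob (eq_integral (fun=> N.+1%:R^-1%:E)); last first.
    move=> x; rewrite inE/= in_itv/= /uniform_pdf subr0 => /andP[kx xk].
    rewrite (le_trans _ kx)// (le_trans (ltW xk))// ler_nat ltnS//.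
  rewrite integral_cst//= lebesgue_measure_itv/= lte_fin kk1 -EFinB -EFinM lee_fin.
  by rewrite -natrB// subSnn mulr1.
apply: le_measure; rewrite ?inE.
- exact: measurable_itv.
- by rewrite -[_ @^-1` _]setTI; exact: (mG measurableT _ (mB k)).
- move=> x; rewrite /= in_itv/= => /truncn_def <-; exact: BG.
Qed.

End nonatomic_measures.

(** * Product measures and the averaged error *)

Section product.
Context (R : realType) d (T : measurableType d) (mu : probability T R).
Local Open Scope ereal_scope.

Let cons_pair n (p : T * n.-tuple T) : n.+1.-tuple T := [the n.+1.-tuple T of p.1 :: p.2].

Let measurable_cons_pair n : measurable_fun setT (@cons_pair n).
Proof. exact: measurable_cons measurable_fst measurable_snd. Qed.

Let xsection_cons n (A : set (n.+1.-tuple T)) x :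
  xsection (@cons_pair n @^-1` A) x = [set t | A (cons_tuple x t)].
Proof.
by apply/seteqP; split=> t; rewrite /xsection/= inE//= /cons_pair/=;
  rewrite (_ : [the _.-tuple T of x :: t] = cons_tuple x t)//; exact/val_inj.
Qed.

(** The iterated integral is the image of [mu \x nu] under consing, starting from the Dirac mass at
    the empty tuple. This supplies nonnegativity and measurable sections. *)
Lemma prod_meas_probability n : exists nu : probability (n.-tuple T) R,
  forall A, measurable A -> prod_meas mu A = nu A.
Proof.
elim: n => [|n [nu nuE]].
  exists (\d_([tuple] : 0.-tuple T)) => A mA /=; rewrite diracE.
  by case: asboolP => h; [rewrite mem_set|rewrite memNset].
pose c : {mfun (T * n.-tuple T)%type >-> n.+1.-tuple T} :=
  HB.pack_for {mfun (T * n.-tuple T)%type >-> n.+1.-tuple T} (@cons_pair n)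
    (isMeasurableFun.Build _ _ _ _ _ (@measurable_cons_pair n)).
exists (distribution (mu \x nu) c) => A mA /=.
apply: eq_integral => x _ /=; rewrite xsection_cons nuE//.
rewrite -xsection_cons; apply: measurable_xsection.
by rewrite -[_ @^-1` _]setTI; exact: (measurable_cons_pair measurableT mA).
Qed.

Lemma prod_meas_ge0 n (A : set (n.-tuple T)) : measurable A -> 0 <= prod_meas mu A.
Proof. by move=> mA; have [nu ->//] := prod_meas_probability n. Qed.

Lemma measurable_prod_meas n (A : set (n.+1.-tuple T)) : measurable A ->
  (forall x, measurable [set t : n.-tuple T | A (cons_tuple x t)]) /\
  measurable_fun setT (fun x => prod_meas mu [set t : n.-tuple T | A (cons_tuple x t)]).
Proof.
move=> mA; have mA' : measurable (@cons_pair n @^-1` A).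
  by rewrite -[_ @^-1` _]setTI; exact: (measurable_cons_pair measurableT mA).
have mx x : measurable [set t : n.-tuple T | A (cons_tuple x t)].
  by rewrite -xsection_cons; exact: measurable_xsection.
split => //; have [nu nuE] := prod_meas_probability n.
have := measurable_fun_xsection nu mA'.
by congr measurable_fun; apply/funext => x; rewrite /= xsection_cons nuE.
Qed.

(** Induction on the sample size: slicing at a first point in [E] preserves the pointwise bound, and
    integrating over [E], of full mass, loses nothing. *)
Lemma prod_meas_sum_ge (I : finType) (E : set T) (c : R) n
    (A : I -> set (n.-tuple T)) :
  measurable E -> 1 <= mu E -> (0 <= c)%R -> (forall i, measurable (A i)) ->
  (forall s, (forall k, E (tnth s k)) -> c%:E <= \sum_i (\1_(A i) s)%:E) ->
  c%:E <= \sum_i prod_meas mu (A i).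
Proof.
move=> mE E1 c0; elim: n A => [|n IH] A mA h.
  apply: le_trans (h [tuple] _) _; first by case.
  apply: lee_sum => i _; rewrite /= indicE.
  by case: asboolP => ?; [rewrite mem_set|rewrite memNset].
have mf i := (measurable_prod_meas (mA i)).2.
have ms i := (measurable_prod_meas (mA i)).1.
rewrite /= -ge0_integral_sum//=; last by move=> i x _; exact: prod_meas_ge0.
have m' : measurable_fun setT (fun x => \sum_i prod_meas mu [set t : n.-tuple T | A i (cons_tuple x t)]).
  exact: emeasurable_sum.
have p0 x : 0 <= \sum_i prod_meas mu [set t : n.-tuple T | A i (cons_tuple x t)].
  by apply: sume_ge0 => i _; exact: prod_meas_ge0.
apply: le_trans (@ge0_subset_integral _ _ _ mu E setT mE measurableT _ m' _ _) => //.
apply: (@le_trans _ _ (\int[mu]_(x in E) c%:E)).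
  by rewrite integral_cst// lee_pemulr// lee_fin.
apply: ge0_le_integral => //=; first exact: measurable_funTS.
move=> x Ex; apply: IH => // s Es.
apply: le_trans (h (cons_tuple x s) _) _; last exact: lee_sum.
move=> k; case: (unliftP ord0 k) => [j|] ->.
  by rewrite (tnthS x s j).
by rewrite tnth0.
Qed.

End product.

(** * Averaged error for a fixed sample *)

Section no_free_lunch.
Context (R : realType) d (T : measurableType d) (mu : probability T R).
Variables (n m : nat) (B : 'I_n -> set T) (C : {ffun 'I_n -> bool} -> set T).
Hypothesis mB : forall i, measurable (B i).
Hypothesis dB : trivIset setT B.
Hypothesis muB : forall i, (n%:R^-1%:E <= mu (B i))%E.
Hypothesis mC : forall J, measurable (C J).
Hypothesis CB : forall J i x, B i x -> C J x <-> J i.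
Variables (H : m.-tuple bool -> set T) (s : m.-tuple T).
Hypothesis mH : forall l, measurable (H l).
Hypothesis Bs : forall k, exists i, B i (tnth s k).

Let flip i (J : {ffun 'I_n -> bool}) := [ffun j => J j (+) (j == i)].

Let flipK i : involutive (flip i).
Proof. by move=> J; apply/ffunP => j; rewrite !ffunE addbK. Qed.

Let X J := H (labelling (C J) s) `+` C J.

Let mX J : measurable (X J).
Proof. by apply: measurableU; apply: measurableD. Qed.

Let e J i := fine (mu (B i `&` X J)).

Let mBX J i : measurable (B i `&` X J). Proof. exact: measurableI. Qed.

(** Both labellings of the sample agree, so the hypothesis is the same, while the two concepts are
    complementary on [B i]: each point of [B i] is an error for one of them. *)
Let e_pair i J : (forall k, ~ B i (tnth s k)) -> n%:R^-1 <= e J i + e (flip i J) i.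
Proof.
move=> nB; rewrite -lee_fin EFinD !fineK ?fin_num_measure//.
apply: le_trans (muB i) _; apply: le_trans (measureU2 _ _ _) => //.
apply: le_measure; rewrite ?inE//; first exact: measurableU.
have lE : labelling (C (flip i J)) s = labelling (C J) s.
  apply: eq_from_tnth => k; rewrite !tnth_map; have [j Bj] := Bs k.
  apply/asbool_equiv_eq; rewrite !(CB _ Bj) ffunE.
  by have [ji|_] := eqVneq j i; [case: (nB k); rewrite -ji|rewrite addbF].
move=> x Bx; rewrite /X lE; have := CB J Bx; have := CB (flip i J) Bx.
rewrite ffunE eqxx addbT => h1 h2.
have [Hx|Hx] := pselect (H (labelling (C J) s) x); case: (boolP (J i)) => Ji.
- by right; split => //; left; split => // /h1; rewrite Ji.
- by left; split => //; left; split => // /h2; rewrite (negbTE Ji).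
- by left; split => //; right; split => //; apply/h2.
- by right; split => //; right; split => //; apply/h1.
Qed.

(** At least [n / 2] of the [B i] are missed, and each contributes at least [2^n / (2n)] to the
    total over [J]. *)
Lemma no_free_lunch : (2 * m <= n)%N -> (0 < n)%N ->
  (2 ^ n)%:R / 4 <= \sum_J fine (mu (X J)).
Proof.
move=> mn n0; have [j Bj] := choice Bs.
pose I := ~: [set j k | k in 'I_m]%SET.
have cI : (n - m <= #|I|)%N.
  rewrite cardsCs finset.setCK card_ord leq_sub2l//.
  by apply: leq_trans (leq_imset_card _ _) _; rewrite card_ord.
have nB i : i \in I -> forall k, ~ B i (tnth s k).
  rewrite inE => /imsetP iI k Bi; apply: iI; exists k => //.
  by apply: dB => //; exists (tnth s k).
have sumJ i : i \in I -> (2 ^ n)%:R / n%:R / 2 <= \sum_J e J i.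
  move=> /nB iI; rewrite ler_pdivrMr// mulr_natr mulr2n.
  (* The sum is doubled and one copy reindexed by the flip, so that [e_pair] bounds each term. *)
  rewrite {2}(reindex_inj (can_inj (flipK i))) -big_split/=.
  apply: (@le_trans _ _ (\sum_(J : {ffun 'I_n -> bool}) n%:R^-1)).
    by rewrite sumr_const card_ffun card_bool card_ord mulr_natl.
  by apply: ler_sum => J _; exact: e_pair.
apply: (@le_trans _ _ (\sum_(i in I) \sum_J e J i)); last first.
  rewrite exchange_big; apply: ler_sum => J _.
  rewrite -lee_fin fineK ?fin_num_measure// -sumEFin.
  under eq_bigr do rewrite fineK ?fin_num_measure//.
  rewrite -measure_bigsetU_ord//; last exact: trivIset_setIr.
  apply: le_measure; rewrite ?inE//; first exact: bigsetU_measurable.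
  by apply: (big_ind (fun Y => Y `<=` X J)) => [//|Y Z YX ZX|i _ x []//];
    rewrite subUset.
apply: (@le_trans _ _ (\sum_(i in I) (2 ^ n)%:R / n%:R / 2)); last exact: ler_sum.
rewrite sumr_const -[X in _ <= X]mulr_natr.
have c2 : n%:R <= 2 * #|I|%:R :> R by rewrite -natrM ler_nat; lia.
have n0' : 0 < n%:R :> R by rewrite ltr0n.
rewrite -!mulrA ler_pM2l ?ltr0n ?expn_gt0// ler_pdivlMl//; lra.
Qed.

End no_free_lunch.

(** * Metrization of the space and the final contradiction *)

Lemma standard_borel_metric (R : realType) d (T : measurableType d) :
  standard_borel R T -> exists dist : T -> T -> R, polish_metric dist /\
    forall A : set T, measurable A <-> <<s metric_open dist >> A.
Proof.
move=> [P [dist [phi [[[d0 deq dC dtri] [D [cD dD]] compl] [psi phiK psiK] mE]]]].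
exists (fun x y => dist (phi x) (phi y)); split.
  split.
  - split=> // x y; split => [/deq/(can_inj phiK)//|->]; exact/deq.
  - exists (psi @` D); split.
      exact: sub_countable (card_image_le _ _) cD.
    move=> x e e0; have [y Dy xy] := dD (phi x) e e0.
    by exists (psi y); [exists y|rewrite psiK].
  - move=> u cu; have [l hl] := compl (phi \o u) cu.
    by exists (psi l) => e e0; have [N hN] := hl e e0; exists N; rewrite psiK.
move=> A; split.
  move=> /mE mA; rewrite (_ : A = phi @^-1` (phi @` A)); last first.
    apply/seteqP; split=> [x Ax|x [y Ay /(can_inj phiK) <-//]].
    by exists x.
  move: (phi @` A) mA; apply: smallest_sub => [|U oU].
    have [s0 sC sU] := smallest_sigma_algebra setT
      (metric_open (fun x y => dist (phi x) (phi y))).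
    split=> /=; first by rewrite preimage_set0.
    - by move=> Y; rewrite setTD preimage_setC -setTD; exact: sC.
    - by move=> F mF; rewrite preimage_bigcup; exact: sU.
  apply: sub_sigma_algebra => x /= /oU[e e0 be].
  by exists e => // y; exact: be.
move: A; apply: (@smallest_sub _ _ _ (@measurable d T)) => [|U oU]; first exact: sigma_algebra_measurable.
apply/mE; apply: sub_sigma_algebra => _ [x Ux <-]; have [e e0 be] := oU x Ux.
exists e => // y /= xy; exists (psi y) => //.
by apply: be; rewrite /= psiK.
Qed.

Theorem mainTheorem11 (R : realType) (d : measure_display) (T : measurableType d)
  (cls : set (set T)) :
  standard_borel R T ->
  (forall C, cls C -> measurable C) ->
  PAC_learnable cls (fun mu : probability T R => nonatomic mu) ->
  VC_mod_omega1_finite cls.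
Proof.
move=> /standard_borel_metric[dist [Hd Hm]] mcls [L [[Lcls _] pac]].
have e0 : 0 < 16^-1 :> R by rewrite invr_gt0.
have [m hm] := pac _ e0 _ e0.
exists (2 * m)%N => n [A [uA shA]]; rewrite leqNgt; apply/negP => mn.
case: n => [//|n] in A uA shA mn *.
have [C0 hC0] := choice shA.
pose C (J : {ffun 'I_n.+1 -> bool}) := C0 J.
have clsC J : cls (C J) := (hC0 J).1.
have mC J := mcls _ (clsC J).
pose B i := \bigcap_(J in [set: {ffun 'I_n.+1 -> bool}]) if J i then C J else ~` C J.
have mB i : measurable (B i).
  apply: fin_bigcap_measurable => [//|J _].
  by case: ifP => _ //; exact: measurableC.
have AB i : A i `<=` B i.
  move=> x Ax J _; have [hJ nJ] := (hC0 J).2 i; case: ifPn => Ji.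
    exact: hJ.
  by move=> Cx; have : (A i `&` C J) x by []; rewrite nJ.
have uB i : ~ countable (B i) by move/(sub_countable_set (AB i)); exact: uA.
have CB J i x : B i x -> C J x <-> J i.
  by move=> /(_ J Logic.I); case: (J i) => h; split.
(* The concept selecting only [i] contains [B i] and avoids every other [B j]. *)
have dB : trivIset setT B.
  apply/trivIsetP => i j _ _ ij; apply/seteqP; split=> // x [Bi Bj].
  have := CB [ffun k => k == i] i x Bi; have := CB [ffun k => k == i] j x Bj.
  by rewrite !ffunE eqxx eq_sym (negbTE ij) => -> [_ /(_ isT)].
(* [inord] extends the finite family to a sequence; indices above [n] repeat a member, so all terms
   stay Borel and uncountable. *)
have [mu [na muB]] := nonatomic_spread Hd Hm n
  (fun k => mB (inord k)) (fun k => uB (inord k)).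
have {}muB i : (n.+1%:R^-1%:E <= mu (B i))%E.
  by have := muB i; rewrite inord_val; apply; rewrite -ltnS.
pose E := \big[setU/set0]_(i < n.+1) B i.
have mE : measurable E by exact: bigsetU_measurable.
have E1 : (1 <= mu E)%E.
  rewrite measure_bigsetU_ord//.
  apply: (@le_trans _ _ (\sum_(i < n.+1) n.+1%:R^-1%:E)%E); last first.
    by apply: lee_sum => i _; exact: muB.
  by rewrite sumEFin sumr_const card_ord -[_ *+ _]mulr_natr mulVf.
have EB x : E x -> exists i, B i x.
  apply: (big_ind (fun Y : set T => Y x -> exists i, B i x)) => [//|Y Z hY hZ []//|i _ Bx].
  by exists i.
(* The outer measure is at most [1/16]; relaxing to [1/8] leaves room to choose an actual measurable
   cover. *)
have /choice[V hV] : forall J, exists V : set (m.-tuple T), [/\ measurable V,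
    [set s | (lr_error mu L (C J) s > (16^-1)%:E)%E] `<=` V &
    (prod_meas mu V <= (8^-1)%:E)%E].
  move=> J.
  have : (prod_outer mu [set s : m.-tuple T | (lr_error mu L (C J) s > (16^-1)%:E)%E] < (8^-1)%:E)%E.
    apply: le_lt_trans (hm m (leqnn m) mu (C J) na (clsC J)) _.
    by rewrite lte_fin; lra.
  by move=> /ereal_inf_lt[_ [V [mV sV] <-] /ltW lV]; exists V.
have mV J : measurable (V J) by have [] := hV J.
have p0 : 0 < (2 ^ n.+1)%:R :> R by rewrite ltr0n expn_gt0.
(* Each error is at most [1/16] off [V J] and at most [1] on it, so an average error of [1/4] forces
   average membership [1/4 - 1/16 = 3/16]. This exceeds the [1/8] allowed by the covers. *)
have : (((2 ^ n.+1)%:R * (3 / 16))%:E <= \sum_J prod_meas mu (V J))%E.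
  apply: (prod_meas_sum_ge mE E1) => // s Es.
  have mH l : measurable (L m s l) by exact/mcls/Lcls.
  have := @no_free_lunch _ _ _ mu n.+1 m B C mB dB muB mC CB (L m s) s mH
    (fun k => EB _ (Es k)) (ltnW mn) isT.
  move=> nfl; rewrite sumEFin lee_fin.
  have le1 J : fine (mu (L m s (labelling (C J) s) `+` C J)) <= 16^-1 + \1_(V J) s.
    have mX : measurable (L m s (labelling (C J) s) `+` C J).
      by apply: measurableU; apply: measurableD.
    have [Vs|Vs] := pselect (V J s).
      rewrite indicE mem_set// -lee_fin fineK ?fin_num_measure//.
      by apply: le_trans (probability_le1 mu mX) _; rewrite lee_fin lerDr ltW.
    rewrite indicE memNset// addr0 -lee_fin fineK ?fin_num_measure//.
    by rewrite leNgt; apply/negP => h; apply: Vs; have [_ + _] := hV J; exact.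
  have := le_trans nfl (ler_sum _ (fun J _ => le1 J)).
  rewrite big_split/= sumr_const card_ffun card_bool card_ord -(mulr_natr 16^-1).
  move: (\sum_J \1_(V J) s) (2 ^ n.+1)%:R => a b; lra.
apply/negP; rewrite -ltNge.
apply: (@le_lt_trans _ _ (\sum_(J : {ffun 'I_n.+1 -> bool}) (8^-1)%:E)%E).
  by apply: lee_sum => J _; have [] := hV J.
rewrite sumEFin sumr_const card_ffun card_bool card_ord lte_fin -(mulr_natr 8^-1).
move: (2 ^ n.+1)%:R p0 => a; lra.
Qed.
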